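(* Let $\sigma\in\mathrm{Aut}_{\mathbb F}(A)$ and let $l_1,\ldots,l_t\in\{1,\ldots,r\}$ be such that $l_i\not\equiv_\sigma l_j$ for $i\ne j$ and such that $o_{l_i}(\sigma)>1$ for all $i=1,\ldots,t$. Put $k_i:=\deg_x\pi_{l_i}$. Then for all $d_1,\ldots,d_t\in\mathbb N_0$ there exists a $\sigma$-cyclic convolutional code $\mathcal C\subseteq\mathbb F[z]^n$ with parameters $(n,k,\delta)$, where $k=\sum_{i=1}^tk_i$ and $\delta=\sum_{i=1}^tk_id_i$, and with support $\{l_1,\ldots,l_t\}$.
   Context: Convolutional codes. $\mathbb F$ is a finite field. Every submodule $\mathcal S\subseteq\mathbb F[z]^n$ is free; if it has rank $k$, then $\mathcal S=\mathrm{im}\,G:=\{uG\mid u\in\mathbb F[z]^k\}$ (row vectors) for some rank-$k$ matrix $G\in\mathbb F[z]^{k\times n}$ (a generator matrix). The complexity of $\mathcal S$ is the maximal degree of the $k$-minors of $G$ (independent of the choice of $G$). A convolutional code with parameters $(n,k,\delta)$ is a submodule $\mathrm{im}\,G\subseteq\mathbb F[z]^n$ of rank $k$ and complexity $\delta$ with $G$ right invertible over $\mathbb F[z]$; equivalently, a direct summand of $\mathbb F[z]^n$. Cyclic structure. The length $n\ge 1$ and $|\mathbb F|$ are coprime. $A:=\mathbb F[x]/\langle x^n-1\rangle$ and $x^n-1=\pi_1\cdots\pi_r$ with monic irreducible pairwise different $\pi_i\in\mathbb F[x]$, ordered by nondecreasing degree. For $k=1,\ldots,r$, $\varepsilon^{(k)}\in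 A$ is the primitive idempotent with $\varepsilon^{(k)}\equiv\delta_{kj}\pmod{\pi_j}$ for all $j$. $\mathrm{Aut}_{\mathbb F}(A)$ is the group of $\mathbb F$-algebra automorphisms of $A$; each such $\sigma$ permutes the $\varepsilon^{(k)}$. Write $k\equiv_\sigma l$ if $\sigma^i(\varepsilon^{(k)})=\varepsilon^{(l)}$ for some $i\in\mathbb N_0$ (an equivalence relation on $\{1,\ldots,r\}$), and $o_l(\sigma):=\min\{m\ge1\mid\sigma^m(\varepsilon^{(l)})=\varepsilon^{(l)}\}$. Let $A[z;\sigma]$ be the skew-polynomial ring with elements $\sum_j z^ja_j$ ($a_j\in A$, coefficients on the right), usual addition, and multiplication determined by $az=z\sigma(a)$ for $a\in A$. For $g\in A[z;\sigma]$ let ${}^{\bullet}\langle g\rangle:=\{fg\mid f\in A[z;\sigma]\}$. Let $\mathfrak p:\mathbb F[z]^n\to A[z;\sigma]$ be the isomorphism of left $\mathbb F[z]$-modules $\sum_j z^jv_j\mapsto\sum_j z^j\mathfrak p(v_j)$, where $\mathfrak p(v_0,\ldots,v_{n-1})=\sum_i v_ix^i\bmod(x^n-1)$ on $\mathbb F^n$. A convolutional code $\mathcal C\subseteq\mathbb F[z]^n$ is $\sigma$-cyclic if $\mathfrak p(\mathcal C)$ is a left ideal of $A[z;\sigma]$. Components and reducedness. For $f\in A[z;\sigma]$ put $f^{(k)}:=\varepsilon^{(k)}f$ and $T_f:=\{k\mid f^{(k)}\ne0\}$ (support of $f$). Monomials are the elements $z^\mu\varepsilon^{(k)}$, ordered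 by $z^\mu\varepsilon^{(k)}<z^\nu\varepsilon^{(l)}$ iff $\mu<\nu$, or $\mu=\nu$ and $k<l$. The terms of $f=\sum_\nu z^\nu f_\nu$ are the elements $z^\nu\varepsilon^{(l)}f_\nu$; for $f\neq 0$, $LM(f)$ is the largest monomial $z^\mu\varepsilon^{(k)}$ with $\varepsilon^{(k)}f_\mu\ne0$. $f$ is reduced if for all $k\ne l$ (with $f^{(l)}\neq0$) no nonzero term of $f^{(k)}$ is right divisible by $LM(f^{(l)})$, i.e. equals $h\cdot LM(f^{(l)})$ with $h\in A[z;\sigma]$. It is known that for every $\sigma$-cyclic code $\mathcal C$ there is a reduced $g$, unique up to left multiplication by units of $A$, with $\mathfrak p(\mathcal C)={}^{\bullet}\langle g\rangle$; $T_g$ is called the support of $\mathcal C$. $\mathbb N_0$ denotes the nonnegative integers. *)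

(* Defs.v *)
From HB Require Import structures.
From mathcomp Require Import all_boot all_order all_algebra.
Set Implicit Arguments.
Unset Strict Implicit.
Unset Printing Implicit Defensive.
Import GRing.Theory.
Local Open Scope ring_scope.

(* R[z; s]: the element \sum_j z^j a_j, coefficients on the right, is stored
   as the {poly R} with coefficients a_j. Since a z = z s(a),
   (z^i a)(z^j b) = z^(i+j) s^j(a) b, whence skew_mul. *)
Definition skewpoly (R : nzRingType) (s : {rmorphism R -> R}) := {poly R}.

HB.instance Definition _ (R : nzRingType) (s : {rmorphism R -> R}) :=
  GRing.Zmodule.on (skewpoly s).

Section SkewPoly.
Variables (R : nzRingType) (s : {rmorphism R -> R}).
Local Notation skewpoly := (skewpoly s).

Definition skew_mul (f g : skewpoly) : skewpoly :=
  \poly_(m < size (f : {poly R}) + size (g : {poly R}))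
    \sum_(j < m.+1) iter j s (f : {poly R})`_(m - j) * (g : {poly R})`_j.

Definition skcoef (f : skewpoly) (m : nat) : R := (f : {poly R})`_m.
Definition skX : skewpoly := 'X.
Definition skC (a : R) : skewpoly := a%:P.

Let iter0 j : iter j s 0 = 0.
Proof. by elim: j => //= j ->; rewrite rmorph0. Qed.
Let iter1 j : iter j s 1 = 1.
Proof. by elim: j => //= j ->; rewrite rmorph1. Qed.
Let iter_add j : {morph iter j s : a b / a + b >-> a + b}.
Proof. by move=> a b; elim: j => //= j ->; rewrite rmorphD. Qed.
Let iter_mul j : {morph iter j s : a b / a * b >-> a * b}.
Proof. by move=> a b; elim: j => //= j ->; rewrite rmorphM. Qed.
Let iter_sum j n (G : 'I_n -> R) :
  iter j s (\sum_i G i) = \sum_i iter j s (G i).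
Proof. exact: (big_morph _ (iter_add j) (iter0 j)). Qed.

Lemma skcoefM f g m :
  skcoef (skew_mul f g) m =
  \sum_(j < m.+1) iter j s (skcoef f (m - j)) * skcoef g j.
Proof.
rewrite /skcoef coef_poly; case: ltnP => // le_m.
rewrite big1 // => j _; have [le_j|lt_j] := leqP (size (g : {poly R})) j.
  by rewrite (nth_default _ le_j) mulr0.
rewrite [X in iter j s X]nth_default ?iter0 ?mul0r //.
rewrite -(leq_add2r j) subnK; last by rewrite -ltnS.
by apply: leq_trans le_m; rewrite leq_add2l ltnW.
Qed.

Lemma skewpolyP (f g : skewpoly) : skcoef f =1 skcoef g -> f = g.
Proof. by move=> eq_fg; apply/polyP. Qed.

Lemma skcoefD f g m : skcoef (f + g) m = skcoef f m + skcoef g m.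
Proof. exact: coefD. Qed.

Lemma skcoefC a m : skcoef (skC a) m = if m == 0%N then a else 0.
Proof. exact: coefC. Qed.

Lemma skew_mulA : associative skew_mul.
Proof.
move=> f g h; apply: skewpolyP => m; rewrite !skcoefM.
transitivity (\sum_(j < m.+1) \sum_(i < m.+1 | (i <= j)%N)
   iter j s (skcoef f (m - j)) * (iter i s (skcoef g (j - i)) * skcoef h i)).
  apply: eq_bigr => j _; rewrite skcoefM big_distrr /=.
  by rewrite (big_ord_narrow_leq (ltn_ord j : (j <= m)%N)).
rewrite (exchange_big_dep predT) //=; apply: eq_bigr => i _.
rewrite skcoefM iter_sum big_distrl /=.
have le_im : (i <= m)%N by rewrite -ltnS.
rewrite -(big_mkord (fun j => (i <= j)%N) (fun j =>
   iter j s (skcoef f (m - j)) * (iter i s (skcoef g (j - i)) * skcoef h i))).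
rewrite -(big_mkord xpredT (fun l =>
   iter i s (iter l s (skcoef f (m - i - l)) * skcoef g l) * skcoef h i)).
rewrite (big_cat_nat (n := i)) //= ?(leq_trans le_im) // big_nat_cond big_pred0 ?add0r.
  rewrite big_nat_cond -{1}[X in index_iota X]add0n big_addn subSn //.
  rewrite [RHS]big_nat_cond; apply: eq_big => [l|l _].
    by rewrite leq_addl !andbT /= -subSn // ltn_subRL addnC.
  by rewrite addnK iter_mul -iterD mulrA (addnC i) (addnC l) subnDA.
by move=> j /=; case: (ltnP j i); rewrite ?andbF.
Qed.

Lemma skew_mul1 : left_id (skC 1) skew_mul.
Proof.
move=> f; apply: skewpolyP => m; rewrite skcoefM big_ord_recr /= subnn.
rewrite skcoefC eqxx iter1 mul1r big1 ?add0r // => j _.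
by rewrite skcoefC subn_eq0 leqNgt ltn_ord iter0 mul0r.
Qed.

Lemma skew_mulr1 : right_id (skC 1) skew_mul.
Proof.
move=> f; apply: skewpolyP => m; rewrite skcoefM big_ord_recl /= subn0.
rewrite skcoefC eqxx mulr1 big1 ?addr0 // => j _.
by rewrite skcoefC mulr0.
Qed.

Lemma skew_mulDl : left_distributive skew_mul +%R.
Proof.
move=> f g h; apply: skewpolyP => m; rewrite skcoefD !skcoefM -big_split /=.
by apply: eq_bigr => j _; rewrite skcoefD iter_add mulrDl.
Qed.

Lemma skew_mulDr : right_distributive skew_mul +%R.
Proof.
move=> f g h; apply: skewpolyP => m; rewrite skcoefD !skcoefM -big_split /=.
by apply: eq_bigr => j _; rewrite skcoefD mulrDr.
Qed.

Lemma skC1_neq0 : skC 1 != 0.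
Proof. exact: (oner_neq0 {poly R}). Qed.

HB.instance Definition _ := GRing.Zmodule_isNzRing.Build skewpoly
  skew_mulA skew_mul1 skew_mulr1 skew_mulDl skew_mulDr skC1_neq0.

Lemma skcoefMC f (a : R) m : skcoef (f * skC a) m = skcoef f m * a.
Proof.
rewrite skcoefM big_ord_recl /= subn0 skcoefC eqxx big1 ?addr0 // => j _.
by rewrite skcoefC mulr0.
Qed.

Lemma skcoefXn j m : skcoef (skX ^+ j) m = (m == j)%:R.
Proof.
elim: j m => [|j IH] m; first by rewrite expr0 skcoefC; case: eqP.
rewrite exprS skcoefM; case: (ltnP j m.+1) => [lt_jm|lt_mj]; last first.
  rewrite (ltn_eqF (ltnW lt_mj : (m < j.+1)%N)) big1 // => i _.
  by rewrite IH ltn_eqF ?mulr0 // (leq_trans (ltn_ord i)).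
rewrite (bigD1 (Ordinal lt_jm)) //= big1 => [|i ne_i]; last first.
  by rewrite IH -(inj_eq val_inj) in ne_i *; rewrite (negPf ne_i) mulr0.
rewrite addr0 IH eqxx mulr1 /skcoef coefX -(eqn_add2r j) subnK // add1n.
by case: eqP; rewrite ?iter1 ?iter0.
Qed.

Lemma skC_skX (a : R) : skC a * skX = skX * skC (s a).
Proof.
apply: skewpolyP => m; rewrite skcoefMC -{2}[skX]expr1 skcoefXn skcoefM.
have X1 j : skcoef skX j = (j == 1%N)%:R by rewrite -skcoefXn expr1.
case: (eqVneq m 1%N) => [->|m1].
  by rewrite !big_ord_recl big_ord0 /= !X1 !skcoefC /= mulr0 mulr1 mul1r add0r addr0.
rewrite mul0r big1 // => j _; rewrite X1; case: (eqVneq (j : nat) 1%N) => [j1|_].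
  rewrite skcoefC subn_eq0 j1 ifF ?iter0 ?mul0r //.
  by move: (ltn_ord j); rewrite j1 ltnS => m_gt0; rewrite leq_eqVlt (negPf m1) ltnNge m_gt0.
by rewrite mulr0.
Qed.

Lemma skewpolyE (f : skewpoly) :
  f = \sum_(j < size (f : {poly R})) skX ^+ j * skC (skcoef f j).
Proof.
apply: skewpolyP => m.
rewrite (big_morph (fun g => skcoef g m) (id1 := 0) (op1 := +%R)); last 2 first.
- by move=> g h; rewrite skcoefD.
- exact: coef0.
transitivity (\sum_(j < size (f : {poly R}) | (j : nat) == m) skcoef f j); last first.
  rewrite big_mkcond; apply: eq_bigr => j _.
  by rewrite skcoefMC skcoefXn eq_sym; case: eqP; rewrite ?mul1r ?mul0r.
have [le_m|lt_m] := leqP (size (f : {poly R})) m.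
  rewrite big1 /skcoef ?nth_default // => j /eqP j_m.
  by move: (ltn_ord j); rewrite j_m ltnNge le_m.
by rewrite (big_pred1 (Ordinal lt_m)).
Qed.

End SkewPoly.

Arguments skX {R s}.
Arguments skC {R s} a.

Section Modules.

Definition left_ideal (R : nzRingType) (I : R -> Prop) : Prop :=
  [/\ I 0, forall f g, I f -> I g -> I (f + g)
    & forall h f, I f -> I (h * f)].

Definition principal_left_ideal (R : nzRingType) (g : R) : R -> Prop :=
  fun f => exists h, f = h * g.

Variable F : fieldType.

Definition im (k n : nat) (G : 'M[{poly F}]_(k, n)) : 'rV[{poly F}]_n -> Prop :=
  fun v => exists u : 'rV[{poly F}]_k, v = u *m G.

(* The k-minors are indexed by the increasing maps 'I_k -> 'I_n. *)
Definition complexity (k n : nat) (G : 'M[{poly F}]_(k, n)) : nat :=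
  \max_(f : {ffun 'I_k -> 'I_n} |
          [forall i : 'I_k, forall j : 'I_k, (i < j)%N ==> (f i < f j)%N])
     (size (\det (colsub f G))).-1.

Definition convolutional_code (n k delta : nat)
    (C : 'rV[{poly F}]_n -> Prop) : Prop :=
  exists G : 'M[{poly F}]_(k, n),
    [/\ forall v, C v <-> im G v,
        \rank (map_mx (@tofrac _) G) = k,
        complexity G = delta
      & exists H : 'M[{poly F}]_(n, k), G *m H = 1%:M].

End Modules.

Notation cyclic_algebra F n := {poly %/ ('X^n - 1 : {poly F})}.

(* The polynomial representative of eps k has degree < n, but the congruences do
   not depend on the representative as each pi j divides 'X^n - 1. *)
Definition primitive_idempotents (F : finFieldType) (n r : nat)
    (pi : 'I_r -> {poly F}) (eps : 'I_r -> cyclic_algebra F n) : Prop :=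
  forall k j, pi j %| (eps k : {poly F}) - (k == j)%:R.

Lemma period_exists (T : finType) (f : T -> T) (inj_f : injective f) (x : T) :
  exists m, (0 < m)%N && (iter m f x == x).
Proof. by exists (fingraph.order f x); rewrite order_gt0 iter_order /=. Qed.

Definition period (T : finType) (f : T -> T) (inj_f : injective f) (x : T) :=
  ex_minn (period_exists inj_f x).

Section Cyclic.
Variables (F : finFieldType) (n r : nat).
Local Notation A := (cyclic_algebra F n).
Variables (eps : 'I_r -> A) (sigma : {lrmorphism A -> A}).
Local Notation skA := (skewpoly sigma).

Definition sigma_equiv (k l : 'I_r) : Prop :=
  exists i : nat, iter i sigma (eps k) = eps l.

Definition vec_to_A (v : 'rV[F]_n) : A :=
  in_qpoly ('X^n - 1) (\sum_(i < n) v 0 i *: 'X^i).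

Definition vec_to_skew (v : 'rV[{poly F}]_n) : skA :=
  \sum_(j < \max_(i < n) size (v 0%R i))
     skX ^+ j * skC (vec_to_A (map_mx (coefp j) v)).

Definition skew_image (C : 'rV[{poly F}]_n -> Prop) : skA -> Prop :=
  fun f => exists2 v, C v & f = vec_to_skew v.

Definition sigma_cyclic (C : 'rV[{poly F}]_n -> Prop) : Prop :=
  left_ideal (skew_image C).

Definition component (k : 'I_r) (f : skA) : skA := skC (eps k) * f.

Definition skew_support (f : skA) : {set 'I_r} := [set k | component k f != 0].

(* The pair (mu, k) encodes the monomial z^mu eps^(k); distinct pairs give
   distinct monomials because the idempotents are pairwise distinct and
   nonzero. *)
Definition monomial (m : nat * 'I_r) : skA := skX ^+ m.1 * skC (eps m.2).

Definition monomial_lt (m m' : nat * 'I_r) : bool :=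
  (m.1 < m'.1)%N || ((m.1 == m'.1) && (m.2 < m'.2)%N).

Definition term (f : skA) (m : nat * 'I_r) : skA :=
  skX ^+ m.1 * skC (eps m.2 * skcoef f m.1).

Definition is_LM (f : skA) (m : nat * 'I_r) : Prop :=
  eps m.2 * skcoef f m.1 != 0 /\
  forall m', eps m'.2 * skcoef f m'.1 != 0 -> m' = m \/ monomial_lt m' m.

Definition reduced (f : skA) : Prop :=
  forall k l : 'I_r, k != l -> component l f != 0 ->
  forall m, is_LM (component l f) m ->
  forall m', term (component k f) m' != 0 ->
  ~ exists h : skA, term (component k f) m' = h * monomial m.

(* A reduced generator is unique up to left multiplication by a unit of A, so
   the support does not depend on its choice. *)
Definition code_support (C : 'rV[{poly F}]_n -> Prop) (T : {set 'I_r}) : Prop :=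
  exists g : skA,
    [/\ reduced g,
        forall f, skew_image C f <-> principal_left_ideal g f
      & skew_support g = T].

End Cyclic.

(* Main.v *)
Require Import Defs.
From HB Require Import structures.
From mathcomp Require Import all_boot all_order all_algebra fingroup perm.
Set Implicit Arguments.
Unset Strict Implicit.
Unset Printing Implicit Defensive.
Import GRing.Theory.
Local Open Scope ring_scope.

(** Let e_i be the primitive idempotent eps (l i) and E the sum of the e_i. The
left ideal of the constant E consists of the skew polynomials with coefficients
in A E; it is a direct summand of rank \sum_i k_i, since A e_i is the field
F[x]/(pi (l i)) of dimension k_i over F. Right multiplication by a unit is an
automorphism of left F[z]-modules, so for every unit u the left ideal of
g = E u is again a direct summand of the same rank, hence a code (lemma
principal_code, where only a right inverse v of g relative to E is needed).

It remains to choose u such that e_i g has degree d_i for each i. This is where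
the assumption on the periods enters: e_i is orthogonal to sigma(e_i), so there
are nilpotent monomials a z^m with idempotent a, and products of at most two
units 1 + a z^m reach every degree (lemma block_generator). The resulting e_i g
has as its coefficients only zero and elements of the sigma-orbit of e_i; its
leading coefficient is sigma^(d_i)(e_i).

Since the orbits of the different e_i are disjoint, hence orthogonal, the
blocks do not interact. The leading coefficients of the rows
x^j e_i g, j < k_i, are the sigma^(d_i)(x^j e_i); they are F-independent because
sigma is injective. So the generator matrix is row reduced and its complexity is
the sum \sum_i k_i d_i of its row degrees (lemma complexity_row_reduced).
Disjointness of the orbits also shows that no nonzero term of one component of g
can be a left multiple of a monomial of another one, so g is reduced, and its support
is visible from its components (lemmas reduced_orbit_sum and
support_orbit_sum). *)

(** * The complexity of row reduced matrices *)

Section RowReduced.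
Variable F : fieldType.

(** The bound D i plays the role of a degree that need not be attained: the
coefficient at D i is then 0, and the statement stays true. *)
Lemma prod_leading (I : Type) (r : seq I) (p : I -> {poly F}) (D : I -> nat) :
    (forall i, (size (p i) <= (D i).+1)%N) ->
  (size (\prod_(i <- r) p i)%R <= (\sum_(i <- r) D i).+1)%N /\
  (\prod_(i <- r) p i)`_(\sum_(i <- r) D i) = \prod_(i <- r) (p i)`_(D i).
Proof.
move=> le_pD; elim: r => [|i r [le_r lead_r]].
  by rewrite !big_nil size_poly1 coef1 eqxx.
rewrite !big_cons -lead_r; split.
  apply: leq_trans (size_polyMleq _ _) _.
  by rewrite -subn1 leq_subLR add1n -addnS -addSn leq_add.
set q := \prod_(j <- r) _ in le_r *; set d := (\sum_(j <- r) _)%N in le_r *.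
have lt_D : (D i < (D i + d).+1)%N by rewrite ltnS leq_addr.
rewrite coefM (bigD1 (Ordinal lt_D)) //= addKn big1 ?addr0 // => j ne_j.
have [lt_j|gt_j|eq_j] := ltngtP (j : nat) (D i); last first.
- by rewrite -(inj_eq val_inj) /= eq_j eqxx in ne_j.
- by rewrite (nth_default _ (leq_trans (le_pD i) gt_j)) mul0r.
rewrite [q`__]nth_default ?mulr0 // (leq_trans le_r) //.
by rewrite ltn_subRL ltn_add2r.
Qed.

Lemma det_leading k (M : 'M[{poly F}]_k) (D : 'I_k -> nat) :
    (forall i j, (size (M i j) <= (D i).+1)%N) ->
  (size (\det M)%R <= (\sum_i D i).+1)%N /\
  (\det M)`_(\sum_i D i) = \det (\matrix_(i, j) (M i j)`_(D i)).
Proof.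
move=> le_MD.
have prodM (s : 'S_k) := prod_leading (index_enum 'I_k)
  (fun i => le_MD i (s i)).
have termE (s : 'S_k) p : (-1) ^+ s * p = ((-1) ^+ s : F) *: p :> {poly F}.
  case: (odd_perm s); first by rewrite expr1 mulN1r scaleN1r.
  by rewrite expr0 mul1r scale1r.
rewrite /determinant; split.
  apply: leq_trans (size_sum _ _ _) _; apply/bigmax_leqP => s _.
  by rewrite termE (leq_trans (size_scale_leq _ _)) //; case: (prodM s).
rewrite coef_sum; apply: eq_bigr => s _; rewrite termE coefZ (prodM s).2.
by congr (_ * _); apply: eq_bigr => i _; rewrite mxE.
Qed.

(** Linear algebra gives an injective choice of k columns with an invertible
minor; listing the same columns in increasing order only permutes them. *)
Lemma row_free_minor k n (L : 'M[F]_(k, n)) : row_free L ->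
  exists f : {ffun 'I_k -> 'I_n},
    [forall i : 'I_k, forall j : 'I_k, (i < j)%N ==> (f i < f j)%N] &&
    (\det (colsub f L) != 0).
Proof.
move=> freeL; have fullL : row_full L^T by rewrite /row_full mxrank_tr.
pose f0 := fullrankfun fullL.
have inj_f0 : injective f0 := @fullrankfun_inj _ _ _ _ fullL.
have det_f0 : \det (colsub f0 L) != 0.
  have := fullrowsub_unit fullL; rewrite unitmxE unitfE -det_tr.
  by congr (\det _ != 0); apply/matrixP => i j; rewrite !mxE.
pose S := [set f0 i | i : 'I_k].
have card_S : #|S| = k by rewrite card_imset // card_ord.
pose f i : 'I_n := Order.enum_val (cast_ord (esym card_S) i).
have inS i : f0 i \in S by apply/imsetP; exists i.
pose q i : 'I_k := cast_ord card_S (Order.enum_rank_in (inS i) (f0 i)).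
have fq i : f (q i) = f0 i.
  by rewrite /f /q cast_ordK Order.enum_rankK_in.
have inj_q : injective q by move=> i j /(congr1 f); rewrite !fq => /inj_f0.
exists (finfun f); apply/andP; split.
  apply/forallP => i; apply/forallP => j; apply/implyP; rewrite !ffunE /f.
  have le_f := @Order.le_enum_val _ 'I_n
    (@Order.TotalTheory.le_total _ 'I_n) (mem S).
  have lt_f := Order.POrderTheory.leW_mono le_f.
  have := lt_f (cast_ord (esym card_S) i) (cast_ord (esym card_S) j).
  by rewrite !Order.OrdinalOrder.ltEord /= => ->.
have eq_f0 : colsub f0 L = col_perm (perm inj_q) (colsub (finfun f) L).
  by apply/matrixP => i j; rewrite !mxE permE (ffunE f) fq.
apply: contraNneq det_f0 => det0.
by rewrite eq_f0 col_permE det_mulmx det0 mul0r.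
Qed.

(** The degree of a minor is at most the sum of the row degrees, with equality
unless the same minor of the matrix of leading row coefficients vanishes; the
rank of that matrix excludes this for all minors at once. *)
Lemma complexity_row_reduced k n (G : 'M[{poly F}]_(k, n)) (D : 'I_k -> nat) :
    (forall i j, (size (G i j) <= (D i).+1)%N) ->
    row_free (\matrix_(i, j) (G i j)`_(D i)) ->
  complexity G = (\sum_i D i)%N.
Proof.
move=> le_GD free_lead.
have minor (f : {ffun 'I_k -> 'I_n}) :
    (size (\det (colsub f G))%R <= (\sum_i D i).+1)%N /\
    (\det (colsub f G))`_(\sum_i D i) =
      \det (\matrix_(i, j) (colsub f G i j)`_(D i)).
  by apply: det_leading => i j; rewrite mxE.
apply/eqP; rewrite eqn_leq; apply/andP; split.
  apply/bigmax_leqP => f _; have [le_det _] := minor f.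
  by rewrite -subn1 leq_subLR add1n.
have [f /andP[incr_f det_f]] := row_free_minor free_lead.
apply: (bigmax_sup f) => //; have [_ lead] := minor f.
have: (\det (colsub f G))`_(\sum_i D i) != 0.
  rewrite lead; congr (\det _ != 0): det_f.
  by apply/matrixP => i j; rewrite !mxE.
apply: contraNT; rewrite -ltnNge => lt_size.
by rewrite nth_default // (leq_trans (leqSpred _)).
Qed.

End RowReduced.

(** * Coordinates of skew polynomials *)

Section SkewTheory.
Variables (R : nzRingType) (s : {rmorphism R -> R}).
Local Notation skR := (skewpoly s).
Implicit Types (f g : skR) (a b : R).

Lemma skcoef0 m : skcoef (0 : skR) m = 0. Proof. exact: coef0. Qed.

Lemma skcoef_sum (I : Type) (r : seq I) (P : pred I) (f : I -> skR) m :
  skcoef (\sum_(i <- r | P i) f i) m = \sum_(i <- r | P i) skcoef (f i) m.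
Proof.
exact: (big_morph (fun g : skR => skcoef g m) (fun f g => skcoefD f g m)
  (skcoef0 m)).
Qed.

Lemma skcoefCM a f m : skcoef (skC a * f) m = iter m s a * skcoef f m.
Proof.
rewrite skcoefM big_ord_recr /= subnn skcoefC eqxx big1 ?add0r // => j _.
by rewrite skcoefC subn_eq0 leqNgt ltn_ord /= iter_fix ?rmorph0 ?mul0r.
Qed.

Lemma iter_rmorphM m a b : iter m s (a * b) = iter m s a * iter m s b.
Proof. by elim: m => //= m ->; rewrite rmorphM. Qed.

Lemma iter_rmorph0 m : iter m s 0 = 0.
Proof. by rewrite iter_fix ?rmorph0. Qed.

Lemma iter_rmorph1 m : iter m s 1 = 1.
Proof. by rewrite iter_fix ?rmorph1. Qed.

Lemma skC0 : skC 0 = 0 :> skR.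
Proof. exact: polyC0. Qed.

Lemma skCD a b : skC (a + b) = skC a + skC b :> skR.
Proof. exact: polyCD. Qed.

Lemma skCM a b : skC (a * b) = skC a * skC b :> skR.
Proof.
apply: skewpolyP => m; rewrite skcoefMC !skcoefC.
by case: eqP => //; rewrite mul0r.
Qed.

Lemma skC1 : skC 1 = 1 :> skR. Proof. by []. Qed.

Lemma skC_skXn a m : skC a * skX ^+ m = skX ^+ m * skC (iter m s a) :> skR.
Proof.
elim: m => [|m IHm]; first by rewrite !expr0 mul1r mulr1.
by rewrite exprSr mulrA IHm -mulrA skC_skX mulrA.
Qed.

Lemma skcoefXnC m a i :
  skcoef (skX ^+ m * skC a : skR) i = if i == m then a else 0.
Proof. by rewrite skcoefMC skcoefXn; case: eqP; rewrite ?mul1r ?mul0r. Qed.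

End SkewTheory.

Section ScalarExtension.
Variables (F : fieldType) (R : algType F) (s : {lrmorphism R -> R}).
Local Notation skR := (skewpoly s).

Lemma iter_linearZ m (x : F) (a : R) : iter m s (x *: a) = x *: iter m s a.
Proof. by elim: m => //= m ->; rewrite linearZ. Qed.

Lemma iter_rmorph_sum m (I : Type) (r : seq I) (P : pred I) (a : I -> R) :
  iter m s (\sum_(i <- r | P i) a i) = \sum_(i <- r | P i) iter m s (a i).
Proof.
apply: (big_morph _ _ (iter_rmorph0 s m)) => {}a b.
by elim: m => //= m ->; rewrite rmorphD.
Qed.

(** The embedding of F[z] into the skew polynomial ring. Since s fixes the
scalars, left multiplication by it is the F[z]-module structure. *)
Definition skew_scalar (p : {poly F}) : skR := map_poly (in_alg R) p.

Lemma skcoef_scalar p m : skcoef (skew_scalar p) m = (p`_m)%:A.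
Proof. exact: coef_map. Qed.

Lemma skcoef_scalarM p (f : skR) m :
  skcoef (skew_scalar p * f) m = \sum_(j < m.+1) p`_(m - j) *: skcoef f j.
Proof.
rewrite skcoefM; apply: eq_bigr => j _.
by rewrite skcoef_scalar iter_linearZ iter_rmorph1 -scalerAl mul1r.
Qed.

Lemma skcoef_scalarMC p (a : R) m :
  skcoef (skew_scalar p * skC a) m = p`_m *: a.
Proof. by rewrite skcoefMC skcoef_scalar -scalerAl mul1r. Qed.

Section Coordinates.
Variables (K : nat) (c : {linear R -> 'rV[F]_K}).

(** The F[z]-linear extension of c, applied coefficient by coefficient. *)
Definition skew_coord (f : skR) : 'rV[{poly F}]_K :=
  \row_i \poly_(m < size (f : {poly R})) c (skcoef f m) 0 i.

Lemma coef_skew_coord f i m :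
  (skew_coord f 0 i)`_m = c (skcoef f m) 0 i.
Proof.
rewrite mxE coef_poly; case: ltnP => // le_fm.
by rewrite /skcoef nth_default // linear0 mxE.
Qed.

Lemma skew_coordC a : skew_coord (skC a) = map_mx polyC (c a).
Proof.
apply/rowP => i; apply/polyP => m; rewrite coef_skew_coord skcoefC !mxE coefC.
by case: eqP => // _; rewrite linear0 mxE.
Qed.

Lemma skew_coord_scalarM p f :
  skew_coord (skew_scalar p * f) = p *: skew_coord f.
Proof.
apply/rowP => i; apply/polyP => m.
rewrite coef_skew_coord skcoef_scalarM mxE coefMr linear_sum summxE.
by apply: eq_bigr => j _; rewrite linearZ mxE coef_skew_coord.
Qed.

Lemma skew_coord_sum (I : Type) (r : seq I) (P : pred I) (f : I -> skR) :
  skew_coord (\sum_(i <- r | P i) f i) = \sum_(i <- r | P i) skew_coord (f i).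
Proof.
apply/rowP => j; apply/polyP => m.
rewrite coef_skew_coord skcoef_sum linear_sum !summxE coef_sum.
by apply: eq_bigr => i _; rewrite coef_skew_coord.
Qed.

(** A spanning relation over F lifts to F[z]: if the b i span R E with
coordinates c, they also span the left ideal of the constant E. *)
Lemma skew_coord_expand (b : 'I_K -> R) (E : R) :
    (forall a, a * E = \sum_i c a 0 i *: b i) ->
  forall h, h * skC E = \sum_i skew_scalar (skew_coord h 0 i) * skC (b i).
Proof.
move=> expand h; apply: skewpolyP => m; rewrite skcoefMC expand skcoef_sum.
by apply: eq_bigr => i _; rewrite skcoef_scalarMC coef_skew_coord.
Qed.

End Coordinates.

(** Right multiplication by g is F[z]-linear because F[z] acts on the left, so
in coordinates it is given by a matrix over F[z]. *)
Lemma skew_coord_mulmx N K (c : {linear R -> 'rV[F]_N}) (x : 'I_N -> R)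
    (c' : {linear R -> 'rV[F]_K}) (f g : skR) :
    (forall a, a = \sum_i c a 0 i *: x i) ->
  skew_coord c' (f * g) =
    skew_coord c f *m \matrix_i skew_coord c' (skC (x i) * g).
Proof.
move=> expand; have {1}->:
    f = \sum_i skew_scalar (skew_coord c f 0 i) * skC (x i).
  by rewrite -(skew_coord_expand (E := 1)) ?skC1 ?mulr1 // => a; rewrite mulr1.
rewrite mulmx_sum_row mulr_suml skew_coord_sum; apply: eq_bigr => i _.
by rewrite -mulrA skew_coord_scalarM rowK.
Qed.

End ScalarExtension.

(** * Codes from principal left ideals *)

Section CyclicCoordinates.
Variables (F : finFieldType) (n : nat).
Hypothesis n_gt0 : (0 < n)%N.
Local Notation A := (cyclic_algebra F n).

Lemma mk_monic_Xn_sub_1 : mk_monic ('X^n - 1 : {poly F}) = 'X^n - 1.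
Proof.
by rewrite /mk_monic monicXnsubC // size_XnsubC // ltnS n_gt0.
Qed.

Lemma size_cyclic (a : A) : (size (a : {poly F}) <= n)%N.
Proof.
have size_h : size (mk_monic ('X^n - 1 : {poly F})) = n.+1.
  by rewrite mk_monic_Xn_sub_1 size_XnsubC.
by rewrite -ltnS -size_h size_mk_monic.
Qed.

Lemma cyclic_val (p : {poly F}) :
  (in_qpoly ('X^n - 1) p : {poly F}) = p %% ('X^n - 1).
Proof.
by rewrite /= mk_monic_Xn_sub_1 -Pdiv.IdomainMonic.modpE ?monicXnsubC.
Qed.

Lemma cyclic_small (p : {poly F}) : (size p <= n)%N ->
  (in_qpoly ('X^n - 1) p : {poly F}) = p.
Proof. by move=> le_pn; rewrite cyclic_val modp_small // size_XnsubC. Qed.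

Definition cyclic_coord (a : A) : 'rV[F]_n := \row_i (a : {poly F})`_i.

Fact cyclic_coord_linear : linear cyclic_coord.
Proof. by move=> x a b; apply/rowP => i; rewrite !mxE coefD coefZ. Qed.
HB.instance Definition _ :=
  GRing.isLinear.Build F A 'rV[F]_n *:%R cyclic_coord cyclic_coord_linear.

Lemma cyclic_coordK : cancel cyclic_coord (@vec_to_A F n).
Proof.
move=> a; apply: val_inj; rewrite /vec_to_A.
have -> : \sum_(i < n) cyclic_coord a 0 i *: 'X^i = a :> {poly F}.
  rewrite -[RHS](coefK (a : {poly F})) poly_def.
  rewrite (big_ord_widen n (fun i => (a : {poly F})`_i *: 'X^i)) ?size_cyclic //.
  rewrite [RHS]big_mkcond; apply: eq_bigr => i _; rewrite mxE.
  by case: ltnP => // le_i; rewrite nth_default // scale0r.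
exact: cyclic_small (size_cyclic a).
Qed.

Lemma vec_to_AK : cancel (@vec_to_A F n) cyclic_coord.
Proof.
move=> v; apply/rowP => i; rewrite mxE /vec_to_A cyclic_small.
  rewrite coef_sum (bigD1 i) //= coefZ coefXn eqxx mulr1 big1 ?addr0 // => j.
  by rewrite coefZ coefXn -(inj_eq val_inj) eq_sym => /negPf->; rewrite mulr0.
apply: leq_trans (size_sum _ _ _) _; apply/bigmax_leqP => j _.
by rewrite (leq_trans (size_scale_leq _ _)) // size_polyXn.
Qed.

Lemma cyclic_expand (a : A) :
  a = \sum_i cyclic_coord a 0 i *: in_qpoly ('X^n - 1) 'X^i.
Proof.
rewrite -{1}(cyclic_coordK a) /vec_to_A linear_sum.
by apply: eq_bigr => i _; rewrite linearZ.
Qed.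

Variable sigma : {lrmorphism A -> A}.
Local Notation skA := (skewpoly sigma).

Lemma skcoef_vec (v : 'rV[{poly F}]_n) m :
  skcoef (vec_to_skew sigma v) m = vec_to_A (map_mx (coefp m) v).
Proof.
rewrite /vec_to_skew skcoef_sum; set N := (\max_(i < n) _)%N.
under eq_bigr do rewrite skcoefXnC eq_sym.
rewrite -big_mkcond /=; have [lt_mN|le_Nm] := ltnP m N.
  by rewrite (big_pred1 (Ordinal lt_mN)).
rewrite big1 => [|j /eqP eq_jm]; last first.
  by have:= ltn_ord j; rewrite eq_jm ltnNge le_Nm.
apply: (can_inj cyclic_coordK); rewrite vec_to_AK linear0.
apply/rowP => i; rewrite !mxE /= nth_default //.
by apply: leq_trans le_Nm; apply: (bigmax_sup i).
Qed.

Lemma vec_to_skewK v : skew_coord cyclic_coord (vec_to_skew sigma v) = v.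
Proof.
apply/rowP => i; apply/polyP => m.
by rewrite coef_skew_coord skcoef_vec /= vec_to_AK mxE.
Qed.

Lemma skew_coordK (f : skA) :
  vec_to_skew sigma (skew_coord cyclic_coord f) = f.
Proof.
apply: skewpolyP => m; rewrite skcoef_vec -[RHS]cyclic_coordK.
by congr vec_to_A; apply/rowP => i; rewrite mxE /= coef_skew_coord.
Qed.

(** The left ideal of g is the image of the constant left ideal of E under right
multiplication by g, and v undoes this multiplication. Hence the rows b s * g
generate the code, and the F[z]-matrix of right multiplication by v, followed
by the coordinates c, is a right inverse of the generator matrix; the last two
hypotheses make that matrix row reduced with row degrees D. *)
Lemma principal_code (K : nat) (b : 'I_K -> A) (c : {linear A -> 'rV[F]_K})
    (E : A) (g v : skA) (D : 'I_K -> nat) :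
    (forall s, c (b s) = delta_mx 0 s) ->
    (forall a, a * E = \sum_s c a 0 s *: b s) ->
    skC E * g = g -> g * v = skC E ->
    (forall s m, (D s < m)%N -> skcoef (skC (b s) * g) m = 0) ->
    (forall x : 'I_K -> F,
       \sum_s x s *: skcoef (skC (b s) * g) (D s) = 0 -> forall s, x s = 0) ->
  convolutional_code K (\sum_s D s)
    (fun w => principal_left_ideal g (vec_to_skew sigma w)).
Proof.
move=> dual_bc expand Eg gv deg_g lead_g.
have bE s : b s * E = b s.
  rewrite expand dual_bc (bigD1 s) //= mxE !eqxx scale1r big1 ?addr0 // => s' ne.
  by rewrite mxE (negPf ne) andbF scale0r.
pose G := \matrix_s skew_coord cyclic_coord (skC (b s) * g).
pose H := \matrix_(i < n) skew_coord c (skC (in_qpoly ('X^n - 1) 'X^i) * v).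
have GH1 : G *m H = 1%:M.
  apply/row_matrixP => s; rewrite row_mul rowK.
  rewrite -(skew_coord_mulmx _ _ _ cyclic_expand) -mulrA gv -skCM bE.
  by rewrite skew_coordC dual_bc map_delta_mx rowE mulmx1.
exists G; split; last by exists H.
- move=> w; split=> [[h def_w]|[u ->]].
    exists (skew_coord c h); rewrite -[LHS](vec_to_skewK) def_w -{1}Eg mulrA.
    rewrite (skew_coord_expand expand) mulr_suml skew_coord_sum mulmx_sum_row.
    by apply: eq_bigr => s _; rewrite -mulrA skew_coord_scalarM rowK.
  exists (\sum_s skew_scalar sigma (u 0 s) * skC (b s)).
  rewrite -[RHS]skew_coordK; congr (vec_to_skew _ _).
  rewrite mulr_suml skew_coord_sum mulmx_sum_row.
  by apply: eq_bigr => s _; rewrite -mulrA skew_coord_scalarM rowK.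
- apply/eqP; apply/row_freeP; exists (map_mx (@tofrac _) H).
  by rewrite -map_mxM GH1 map_mx1.
apply: complexity_row_reduced => [s i|].
  apply/leq_sizeP => m lt_Dm.
  by rewrite mxE coef_skew_coord deg_g //= linear0 mxE.
apply: inj_row_free => x; rewrite mulmx_sum_row => x0.
apply/rowP => s; rewrite mxE; move: s; apply: lead_g.
apply: (can_inj cyclic_coordK); rewrite linear_sum linear0 -[RHS]x0.
apply: eq_bigr => s _; rewrite linearZ; congr (_ *: _).
by apply/rowP => i; rewrite [RHS]mxE [in RHS]mxE [G s i]mxE coef_skew_coord.
Qed.
Lemma skew_image_principal (g f : skA) :
  skew_image (fun w => principal_left_ideal g (vec_to_skew sigma w)) f <->
  principal_left_ideal g f.
Proof.
split=> [[w gw ->]//|gf].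
by exists (skew_coord cyclic_coord f); rewrite skew_coordK.
Qed.

Lemma sigma_cyclic_principal (g : skA) :
  sigma_cyclic sigma
    (fun w => principal_left_ideal g (vec_to_skew sigma w)).
Proof.
split=> [|f1 f2|h f].
- by apply/skew_image_principal; exists 0; rewrite mul0r.
- move=> /skew_image_principal[h1 ->] /skew_image_principal[h2 ->].
  by apply/skew_image_principal; exists (h1 + h2); rewrite mulrDl.
- move=> /skew_image_principal[h1 ->].
  by apply/skew_image_principal; exists (h * h1); rewrite mulrA.
Qed.

End CyclicCoordinates.


(** * Primitive idempotents and their orbits *)

Section Idempotents.
Variables (F : finFieldType) (n : nat).
Hypothesis n_gt0 : (0 < n)%N.
Local Notation A := (cyclic_algebra F n).
Variables (r : nat) (pi : 'I_r -> {poly F}).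
Hypothesis pi_monic : forall j, pi j \is monic.
Hypothesis pi_irr : forall j, irreducible_poly (pi j).
Hypothesis pi_inj : injective pi.
Hypothesis pi_prod : \prod_(j < r) pi j = 'X^n - 1.
Variable eps : 'I_r -> A.
Hypothesis epsP : primitive_idempotents pi eps.

Definition residue (j : 'I_r) (a : A) : {poly F} := (a : {poly F}) %% pi j.

Fact residue_linear j : linear (residue j).
Proof. by move=> x a b; rewrite /residue modpD modpZl. Qed.
HB.instance Definition _ j :=
  GRing.isLinear.Build F A {poly F} *:%R (residue j) (residue_linear j).

Lemma size_residue j a : (size (residue j a) < size (pi j))%N.
Proof. by rewrite ltn_modp monic_neq0. Qed.

Lemma residue_in j p : residue j (in_qpoly ('X^n - 1) p) = p %% pi j.
Proof.
have dvd_pi : pi j %| 'X^n - 1.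
  by rewrite -pi_prod (bigD1 j) //= dvdp_mulr.
rewrite /residue cyclic_val // {2}(divp_eq p ('X^n - 1)) modpD.
by rewrite (modp_eq0 (dvdp_mull _ dvd_pi)) add0r.
Qed.

Lemma residueM j a b : residue j (a * b) = (residue j a * residue j b) %% pi j.
Proof.
by rewrite [LHS]residue_in /residue modp_mul [in RHS]mulrC modp_mul mulrC.
Qed.

Lemma residue1 j : residue j 1 = 1.
Proof. by rewrite /residue modp_small // size_poly1 (pi_irr j).1. Qed.

Lemma pi_coprime i j : i != j -> coprimep (pi i) (pi j).
Proof.
move=> ne_ij; rewrite irreducible_poly_coprime //; apply: contra ne_ij => dvd_ij.
have ne1 : size (pi i) != 1 by rewrite gtn_eqF // (pi_irr i).1.
have := (pi_irr j).2 _ ne1 dvd_ij.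
by rewrite eqp_monic // => /eqP/pi_inj->.
Qed.

Lemma dvdp_Xn_sub_1 p : (forall j, pi j %| p) -> 'X^n - 1 %| p.
Proof.
move=> dvd_p; rewrite -pi_prod.
elim: (index_enum _) (index_enum_uniq 'I_r) => [|j js IHjs].
  by rewrite big_nil dvd1p.
case/andP=> j_js uniq_js; rewrite big_cons Gauss_dvdp ?dvd_p ?IHjs //.
rewrite big_seq; elim/big_ind: _ => [|p1 p2|i js_i]; first exact: coprimep1.
  by rewrite coprimepMr => -> ->.
by apply: pi_coprime; apply: contraNneq j_js => ->.
Qed.

(** The uniqueness half of the Chinese remainder theorem; identities in the
cyclic algebra are proved below by comparing residues. *)
Lemma residue_inj a b : (forall j, residue j a = residue j b) -> a = b.
Proof.
move=> eq_ab; apply/eqP; rewrite -subr_eq0; apply/eqP; set c := a - b.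
have dvd_c j : pi j %| (c : {poly F}).
  by rewrite /dvdp -/(residue j c) raddfB /= eq_ab subrr.
have := dvdp_Xn_sub_1 dvd_c; rewrite /dvdp modp_small => [/eqP c0|].
  exact: val_inj.
by rewrite size_XnsubC // ltnS size_cyclic.
Qed.

Lemma residue_eps j k : residue j (eps k) = (k == j)%:R.
Proof.
have /modp_eq0/eqP := epsP k j; rewrite modpD modpN subr_eq0 => /eqP eq_r.
rewrite /residue eq_r modp_small // -polyC_natr.
by rewrite (leq_ltn_trans (size_polyC_leq1 _)) ?(pi_irr j).1.
Qed.

Lemma residue_mul_eps j a k :
  residue j (a * eps k) = if k == j then residue j a else 0.
Proof.
rewrite residueM residue_eps; case: eqP => _; rewrite ?mulr0 ?mod0p // mulr1.
by rewrite modp_small // size_residue.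
Qed.

Lemma eps_mul k k' : eps k * eps k' = if k == k' then eps k else 0.
Proof.
apply: residue_inj => j; rewrite residue_mul_eps.
case: (eqVneq k k') => [->|ne]; rewrite ?linear0 residue_eps; case: eqVneq => //.
by move=> <-; rewrite (negPf ne).
Qed.

Lemma eps_idem k : eps k * eps k = eps k.
Proof. by rewrite eps_mul eqxx. Qed.

Lemma eps_neq0 k : eps k != 0.
Proof.
apply/eqP => /(congr1 (residue k)); rewrite residue_eps eqxx linear0.
by move/eqP; rewrite oner_eq0.
Qed.

Lemma sum_eps : \sum_k eps k = 1.
Proof.
apply: residue_inj => j; rewrite linear_sum residue1 (bigD1 j) //= residue_eps.
rewrite eqxx big1 ?addr0 // => k /negPf ne_k.
by rewrite residue_eps ne_k.
Qed.

(** The residue modulo the irreducible pi k of an idempotent is 0 or 1. *)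
Lemma idem_mul_eps q k : q * q = q -> q * eps k = 0 \/ q * eps k = eps k.
Proof.
move=> idem_q; set p := residue k q.
have /eqP : p * (p - 1) %% pi k = 0.
  rewrite mulrBr mulr1 modpD modpN -residueM idem_q.
  by rewrite /p (modp_small (size_residue k q)) subrr.
rewrite -/(_ %| _) => dvd_pp.
have pE : p = 0 \/ p = 1.
  have [dvd_p|ndvd_p] := boolP (pi k %| p).
    by left; rewrite -(modp_eq0 dvd_p) modp_small // size_residue.
  right; rewrite Gauss_dvdpr ?irreducible_poly_coprime // in dvd_pp.
  apply/eqP; rewrite -subr_eq0 -(modp_eq0 dvd_pp) modp_small //.
  by rewrite /p -(residue1 k) -linearB size_residue.
case: pE => pE; [left | right]; apply: residue_inj => j;
  rewrite residue_mul_eps ?linear0 ?residue_eps; case: eqP => // <-; exact: pE.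
Qed.

(** As an F-space, A eps k is F[x]/(pi k), so the powers of x below the degree
of pi k, multiplied by eps k, form a basis. The coordinates of a eps k are the
coefficients of the residue of a. *)
Lemma eps_expand k a :
  a * eps k = \sum_(j < (size (pi k)).-1)
    (residue k a)`_j *: (in_qpoly ('X^n - 1) 'X^j * eps k).
Proof.
apply: residue_inj => i; rewrite residue_mul_eps linear_sum /=.
under eq_bigr do rewrite linearZ /= residue_mul_eps.
case: eqP => [->|_]; last by rewrite big1 // => j _; rewrite scaler0.
have size_res : (size (residue i a) <= (size (pi i)).-1)%N.
  by rewrite -ltnS (leq_trans (size_residue i a)) // leqSpred.
rewrite -[LHS]coefK poly_def.
rewrite (big_ord_widen _ (fun j => (residue i a)`_j *: 'X^j) size_res).
rewrite big_mkcond; apply: eq_bigr => j _.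
rewrite residue_in modp_small; last first.
  rewrite size_polyXn (leq_ltn_trans (ltn_ord j)) // ltn_predL ltnW //.
  exact: (pi_irr i).1.
by case: ltnP => // le; rewrite nth_default // scale0r.
Qed.

Lemma coef_residue_basis i k (j j' : nat) : (j < (size (pi k)).-1)%N ->
  (residue i (in_qpoly ('X^n - 1) 'X^j * eps k))`_j' =
    ((k == i) && (j' == j))%:R.
Proof.
move=> lt_j; rewrite residue_mul_eps.
case: eqP => [<-|_]; last by rewrite coef0.
rewrite residue_in modp_small ?coefXn //.
by rewrite size_polyXn (leq_ltn_trans lt_j) // ltn_predL ltnW // (pi_irr k).1.
Qed.

Definition residue_coord (K : nat) (k : 'I_K -> 'I_r) (j : 'I_K -> nat)
  (a : A) : 'rV[F]_K := \row_s (residue (k s) a)`_(j s).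

Fact residue_coord_linear K k j : linear (@residue_coord K k j).
Proof.
by move=> x a b; apply/rowP => s; rewrite !mxE linearP coefD coefZ.
Qed.
HB.instance Definition _ K k j :=
  GRing.isLinear.Build F A 'rV[F]_K *:%R (@residue_coord K k j)
    (residue_coord_linear k j).


Variable sigma : {lrmorphism A -> A}.
Hypothesis sigma_inj : injective sigma.
Hypothesis sigma_surj : forall a, exists b, sigma b = a.

(** Choose j with sigma (eps k) * eps j nonzero. By primitivity of eps j the
product is eps j; pulling eps j back along sigma and using primitivity of
eps k, it is also sigma (eps k). *)
Lemma sigma_eps k : exists j, sigma (eps k) = eps j.
Proof.
have idem_s : sigma (eps k) * sigma (eps k) = sigma (eps k).
  by rewrite -rmorphM eps_idem.
have [j ne0] : exists j, sigma (eps k) * eps j != 0.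
  apply/existsP; apply: contraT; rewrite negb_exists => /forallP all0.
  have /eqP[] := eps_neq0 k; apply: sigma_inj; rewrite linear0.
  rewrite -[LHS]mulr1 -sum_eps mulr_sumr big1 // => j _.
  by apply/eqP; have := all0 j; rewrite negbK.
exists j; have [/eqP|<-] := idem_mul_eps j idem_s; first by rewrite (negPf ne0).
have [b def_b] := sigma_surj (eps j); rewrite -def_b -rmorphM in ne0 *.
have idem_b : b * b = b.
  by have := eps_idem j; rewrite -def_b -rmorphM; apply: sigma_inj.
rewrite mulrC in ne0 *; have [b0|->//] := idem_mul_eps k idem_b.
by rewrite b0 rmorph0 eqxx in ne0.
Qed.

Lemma iter_sigma_eps m k : exists j, iter m sigma (eps k) = eps j.
Proof.
elim: m => [|m [j /= ->]]; first by exists k.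
exact: sigma_eps.
Qed.

Lemma iter_sigma_inj m : injective (iter m sigma).
Proof. by elim: m => // m IHm a b /= /sigma_inj /IHm. Qed.

Lemma iter_sigma_eps_orthogonal m k :
  iter m sigma (eps k) = eps k \/ iter m sigma (eps k) * eps k = 0.
Proof.
have [j ->] := iter_sigma_eps m k; rewrite eps_mul.
by case: eqP => [->|_]; [left | right].
Qed.

Variables (t : nat) (l : 'I_t -> 'I_r).
Hypothesis l_inequiv :
  forall i j : 'I_t, i != j -> ~ sigma_equiv eps sigma (l i) (l j).

Lemma inequiv_inj : injective l.
Proof.
move=> i j eq_l; apply/eqP; apply: contraT => ne_ij.
by case: (l_inequiv ne_ij); exists 0%N; rewrite eq_l.
Qed.

Lemma disjoint_orbits i j a b : i != j ->
  iter a sigma (eps (l i)) <> iter b sigma (eps (l j)).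
Proof.
move=> ne_ij; have [le_ab|/ltnW le_ba] := leqP a b.
  rewrite -(subnKC le_ab) iterD => /iter_sigma_inj eq_e.
  by apply: (@l_inequiv j i); [rewrite eq_sym | exists (b - a)%N].
rewrite -(subnKC le_ba) iterD => /iter_sigma_inj eq_e.
by apply: (@l_inequiv i j) => //; exists (a - b)%N.
Qed.

Lemma orthogonal_orbits i j a b : i != j ->
  iter a sigma (eps (l i)) * iter b sigma (eps (l j)) = 0.
Proof.
move=> ne_ij; have := @disjoint_orbits i j a b ne_ij.
have [ki ->] := iter_sigma_eps a (l i); have [kj ->] := iter_sigma_eps b (l j).
by rewrite eps_mul; case: eqP => // -> [].
Qed.

Section OrbitSum.
Local Notation skA := (skewpoly sigma).
Variable f : 'I_t -> skA.
Hypothesis f_comp : forall i, skC (eps (l i)) * f i = f i.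

Lemma eps_mul_other i j : i != j -> skC (eps (l i)) * f j = 0.
Proof.
move=> ne_ij; rewrite -(f_comp j) mulrA -skCM.
by rewrite (@orthogonal_orbits i j 0%N 0%N ne_ij) skC0 mul0r.
Qed.

Lemma component_orbit_sum i : component eps (l i) (\sum_j f j) = f i.
Proof.
rewrite /component mulr_sumr (bigD1 i) //= f_comp big1 ?addr0 // => j ne_ji.
by rewrite eps_mul_other // eq_sym.
Qed.

Lemma component_orbit_sum_neq0 k :
  component eps k (\sum_j f j) != 0 -> exists i, k = l i.
Proof.
have [/codomP[i ->]|notin_l] := boolP (k \in codom l); first by exists i.
rewrite /component mulr_sumr big1 ?eqxx // => i _.
rewrite -f_comp mulrA -skCM eps_mul; case: eqP => [eq_k|_].
  by rewrite eq_k codom_f in notin_l.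
by rewrite skC0 mul0r.
Qed.

Lemma support_orbit_sum : (forall i, f i != 0) ->
  skew_support eps (\sum_j f j) = [set l i | i : 'I_t].
Proof.
move=> f_neq0; apply/setP => k; rewrite inE.
apply/idP/imsetP => [/component_orbit_sum_neq0[i ->]|[i _ ->]]; first by exists i.
by rewrite component_orbit_sum.
Qed.

Hypothesis f_coef : forall i m,
  skcoef (f i) m = 0 \/ skcoef (f i) m = iter m sigma (eps (l i)).

Lemma orbit_sum_mul_other i j a :
  i != j -> f i * skC (iter a sigma (eps (l j))) = 0.
Proof.
move=> ne_ij; apply: skewpolyP => m; rewrite skcoefMC skcoef0.
by have [->|->] := f_coef i m; rewrite ?mul0r ?orthogonal_orbits.
Qed.

Lemma eps_mul_coef i k m :
  eps k * skcoef (f i) m != 0 -> eps k = iter m sigma (eps (l i)).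
Proof.
have [->|->] := f_coef i m; rewrite ?mulr0 ?eqxx //.
have [j ->] := iter_sigma_eps m (l i); rewrite eps_mul.
by case: (eqVneq k j) => [->|]; rewrite ?eqxx.
Qed.

(** All monomials of f i are of the form z^m eps' with eps' in the orbit of
eps (l i). A left multiple of z^m eps' is fixed by right multiplication by
eps', so it cannot be a nonzero term of another component, whose idempotent
lies in a different orbit. *)
Lemma reduced_orbit_sum : reduced eps (\sum_j f j).
Proof.
move=> k k' ne_k /component_orbit_sum_neq0[i' def_k'] m [].
rewrite def_k' component_orbit_sum => /eps_mul_coef def_m _ m' nz_term.
case=> h def_term.
have [i def_k] : exists i, k = l i.
  apply: component_orbit_sum_neq0; apply: contraNneq nz_term => ->.
  by rewrite /term skcoef0 mulr0 skC0 mulr0.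
rewrite def_k component_orbit_sum in nz_term def_term.
have /eps_mul_coef def_m' : eps m'.2 * skcoef (f i) m'.1 != 0.
  by apply: contraNneq nz_term => t0; rewrite /term t0 skC0 mulr0.
have ne_i : i != i'.
  by apply: contraNneq ne_k => eq_i; rewrite def_k def_k' eq_i.
have orth_mm' : eps m.2 * eps m'.2 = 0.
  by rewrite def_m def_m'; apply: orthogonal_orbits; rewrite eq_sym.
have fix_term : term eps (f i) m' * skC (eps m'.2) = term eps (f i) m'.
  rewrite -mulrA -skCM; congr (_ * skC _).
  by rewrite mulrAC eps_idem.
case/eqP: nz_term; rewrite -fix_term def_term -!mulrA -skCM orth_mm' skC0.
by rewrite !mulr0.
Qed.

End OrbitSum.

End Idempotents.

(** * A generator of prescribed degree for one orbit *)

Section Block.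
Variables (R : comNzRingType) (s : {rmorphism R -> R}).
Local Notation skR := (skewpoly s).

Lemma mul_1D_1B (T : nzRingType) (p : T) : p * p = 0 -> (1 + p) * (1 - p) = 1.
Proof.
by move=> pp0; rewrite mulrBr mulr1 mulrDl mul1r pp0 addr0 addrK.
Qed.

Lemma skew_nilpotent (a : R) d : iter d s a * a = 0 ->
  (skC a * skX ^+ d) * (skC a * skX ^+ d) = 0 :> skR.
Proof.
move=> aa0; rewrite {1}skC_skXn -mulrA (mulrA (skC _) (skC a)) -skCM aa0.
by rewrite skC0 mul0r mulr0.
Qed.

Variable e : R.
Hypothesis e_idem : e * e = e.
Hypothesis e_orbit : forall m, iter m s e = e \/ iter m s e * e = 0.
Hypothesis e_moved : s e * e = 0.

Let eC : skC e * skC e = skC e :> skR. Proof. by rewrite -skCM e_idem. Qed.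

(** The single orbit case. Right multiplication of e by a unit leaves its left
ideal a direct summand, and 1 + a z^m is a unit as soon as a z^m squares to 0,
that is, when the m-th image of a is orthogonal to a. For d = 0, take g = e. If
the d-th image of e is orthogonal to e, then g = e + e z^d is obtained from one
such unit. Otherwise that image is e itself; as e is moved by s, the degree d
can still be reached in two steps, (1 + e z)(1 + s(e) z^(d-1)), which gives
g = e + e z + e z^d. The second component w describes the inverse unit 1 + w;
its last property lets the inverses of several orbits be added up. *)
Lemma block_generator (d : nat) : exists gw : skR * skR,
  [/\ skC e * gw.1 = gw.1 /\ gw.1 * (1 + gw.2) = skC e,
      forall m, skcoef gw.1 m = 0 \/ skcoef gw.1 m = iter m s e,
      forall m, (d < m)%N -> skcoef gw.1 m = 0,
      skcoef gw.1 d = iter d s e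
    & forall f : skR, f * skC e = 0 -> f * skC (s e) = 0 -> f * gw.2 = 0].
Proof.
have [->|d_gt0] := posnP d.
  exists (skC e, 0) => /=; split=> //.
  - by rewrite addr0 mulr1.
  - by case=> [|m]; rewrite skcoefC; [right|left].
  - by case=> // m _; rewrite skcoefC.
  - by rewrite skcoefC.
  - by move=> f _ _; rewrite mulr0.
have coef_g m i :
    skcoef (skC e * skX ^+ m : skR) i = if i == m then iter m s e else 0.
  by rewrite skC_skXn skcoefXnC.
have [ed0|ed_neq0] := eqVneq (iter d s e * e) 0.
  pose p : skR := skC e * skX ^+ d.
  have ep : skC e * p = p by rewrite mulrA eC.
  exists (skC e * (1 + p), - p) => /=; split.
  - by rewrite mulrA eC -mulrA mul_1D_1B ?mulr1 ?skew_nilpotent.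
  - move=> m; rewrite mulrDr mulr1 ep skcoefD skcoefC coef_g.
    have [->|m_neq0] := eqVneq m 0%N.
      by rewrite ltn_eqF // addr0; right.
    by rewrite add0r; case: eqP => [->|_]; [right|left].
  - move=> m lt_dm; rewrite mulrDr mulr1 ep skcoefD skcoefC coef_g.
    by rewrite !gtn_eqF ?addr0 // (leq_trans d_gt0) // ltnW.
  - by rewrite mulrDr mulr1 ep skcoefD skcoefC coef_g eqxx gtn_eqF // add0r.
  - by move=> f fe _; rewrite mulrN mulrA fe mul0r oppr0.
have ed : iter d s e = e.
  by case: (e_orbit d) => // /eqP; rewrite (negPf ed_neq0).
(* d = 1 is excluded because e is moved by s *)
have d_gt1 : (1 < d)%N.
  case: d d_gt0 ed_neq0 {ed} => [|[|d]] //= _.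
  by rewrite e_moved eqxx.
pose p : skR := skC e * skX ^+ 1; pose q : skR := skC (s e) * skX ^+ d.-1.
have pp1 : (1 + p) * (1 - p) = 1 by rewrite mul_1D_1B // skew_nilpotent.
have qq1 : (1 + q) * (1 - q) = 1.
  rewrite mul_1D_1B // skew_nilpotent // -iterSr prednK // ed mulrC.
  exact: e_moved.
have gE : skC e * ((1 + p) * (1 + q)) = skC e + p + skC e * skX ^+ d.
  have eq0 : skC e * q = 0.
    by rewrite mulrA -skCM mulrC e_moved skC0 mul0r.
  have ep : skC e * p = p by rewrite mulrA eC.
  rewrite mulrA [skC e * (1 + p)]mulrDr mulr1 ep mulrDr mulr1 mulrDl.
  rewrite eq0 add0r; congr (_ + _).
  rewrite /p /q mulrA -(mulrA (skC e)) -(skC_skXn s e 1) mulrA eC -mulrA -exprD.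
  by rewrite add1n prednK.
exists (skC e * ((1 + p) * (1 + q)), (1 - q) * (1 - p) - 1) => /=; split.
- split; first by rewrite mulrA eC.
  rewrite addrCA subrr addr0 -!mulrA.
  by rewrite (mulrA (1 + q)) qq1 mul1r pp1 mulr1.
- move=> m; rewrite gE !skcoefD skcoefC !coef_g.
  have [->|m_neq0] := eqVneq m 0%N.
    by rewrite !ltn_eqF // !addr0; right.
  rewrite add0r; have [->|m_neq1] := eqVneq m 1%N.
    by rewrite (ltn_eqF d_gt1) addr0; right.
  by rewrite add0r; case: eqP => [->|_]; [right|left].
- move=> m lt_dm; rewrite gE !skcoefD skcoefC !coef_g.
  by rewrite !gtn_eqF ?addr0 // (leq_trans _ lt_dm) // ltnW.
- by rewrite gE !skcoefD skcoefC !coef_g eqxx !gtn_eqF // !add0r.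
- move=> f fe fse; have fp : f * p = 0 by rewrite mulrA fe mul0r.
  have fq : f * q = 0 by rewrite mulrA fse mul0r.
  have f1q : f * (1 - q) = f by rewrite mulrBr mulr1 fq subr0.
  by rewrite mulrBr mulr1 mulrA f1q mulrBr mulr1 fp subr0 subrr.
Qed.

End Block.

(** * The code with several orbits *)

Lemma tagnat_eq (t : nat) (p : 'I_t -> nat) (s s' : 'I_(\sum_i p i)%N) :
  tagnat.sig1 s = tagnat.sig1 s' ->
  tagnat.sig2 s = tagnat.sig2 s' :> nat -> s = s'.
Proof.
move=> eq1 eq2; apply: tagnat.sig_inj; move: eq1 eq2.
rewrite /tagnat.sig2 /tagnat.sig1.
case: (tagnat.sig s) => i a; case: (tagnat.sig s') => i' a' /= eq_i.
by case: i' / eq_i a' => a' /val_inj->.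
Qed.

Lemma tagnat_sum (V : nmodType) (t : nat) (p : 'I_t -> nat)
    (f : 'I_t -> nat -> V) :
  \sum_(s < (\sum_i p i)%N) f (tagnat.sig1 s) (tagnat.sig2 s) =
  \sum_i \sum_(j < p i) f i j.
Proof.
rewrite (sig_big_dep _ _ (fun i (j : 'I_(p i)) => f i j)) /=.
by rewrite (reindex _ tagnat.sig_bij_on).
Qed.

Lemma dual_free (F : fieldType) (V : lmodType F) (K : nat)
    (c : {linear V -> 'rV[F]_K}) (b : 'I_K -> V) (P : pred 'I_K)
    (x : 'I_K -> F) :
    (forall s, c (b s) = delta_mx 0 s) -> \sum_(s | P s) x s *: b s = 0 ->
  forall s, P s -> x s = 0.
Proof.
move=> dual_bc /(congr1 c) x0 s Ps; move/rowP/(_ s): x0.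
rewrite linear0 [RHS]mxE linear_sum summxE (bigD1 s) //= big1 ?addr0 => [|s'].
  by rewrite linearZ mxE dual_bc mxE !eqxx mulr1.
case/andP=> _ ne_s; rewrite linearZ mxE dual_bc mxE eq_sym (negPf ne_s).
by rewrite andbF mulr0.
Qed.

Theorem corollary4p3 (F : finFieldType) (n : nat) (n_gt0 : (0 < n)%N)
  (coprime_nF : coprime n #|F|)
  (r : nat) (pi : 'I_r -> {poly F})
  (pi_monic : forall j, pi j \is monic)
  (pi_irr : forall j, irreducible_poly (pi j))
  (pi_inj : injective pi)
  (pi_ordered : forall i j : 'I_r, (i <= j)%N -> (size (pi i) <= size (pi j))%N)
  (pi_prod : \prod_(j < r) pi j = 'X^n - 1)
  (eps : 'I_r -> cyclic_algebra F n)
  (epsP : primitive_idempotents pi eps)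
  (sigma : {lrmorphism cyclic_algebra F n -> cyclic_algebra F n})
  (sigma_bij : bijective sigma)
  (t : nat) (l : 'I_t -> 'I_r)
  (l_inequiv : forall i j : 'I_t, i != j -> ~ sigma_equiv eps sigma (l i) (l j))
  (l_period : forall i : 'I_t, (1 < period (bij_inj sigma_bij) (eps (l i)))%N)
  (d : 'I_t -> nat) :
  let k_ (i : 'I_t) := (size (pi (l i))).-1 in
  exists C : 'rV[{poly F}]_n -> Prop,
    [/\ convolutional_code (\sum_(i < t) k_ i) (\sum_(i < t) k_ i * d i) C,
        sigma_cyclic sigma C
      & code_support eps sigma C [set l i | i : 'I_t]].
Proof.
move=> k_.
have sigma_inj := bij_inj sigma_bij.
have sigma_surj a : exists b, sigma b = a.
  by move: (sigma_bij) => [tau _ tauK]; exists (tau a).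
have e_idem := eps_idem n_gt0 pi_monic pi_irr pi_inj pi_prod epsP.
have e_iter := iter_sigma_eps n_gt0 pi_monic pi_irr pi_inj pi_prod epsP
  sigma_inj sigma_surj.
have e_orbit := iter_sigma_eps_orthogonal n_gt0 pi_monic pi_irr pi_inj pi_prod
  epsP sigma_inj sigma_surj.
have orth := orthogonal_orbits n_gt0 pi_monic pi_irr pi_inj pi_prod epsP
  sigma_inj sigma_surj l_inequiv.
have l_inj := inequiv_inj l_inequiv.
have e_moved i : sigma (eps (l i)) * eps (l i) = 0.
  have [fix_e|//] := e_orbit 1%N (l i).
  have := l_period i; rewrite /period; case: ex_minnP => m _ min_m.
  by rewrite ltnNge min_m //=; apply/eqP; exact: fix_e.
have /fin_all_exists[gw gwP] i := block_generator
  (e_idem (l i)) (e_orbit^~ (l i)) (e_moved i) (d i).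
pose g_ i := (gw i).1; pose w_ i := (gw i).2.
have g_comp i : skC (eps (l i)) * g_ i = g_ i by have [[]] := gwP i.
have g_inv i : g_ i * (1 + w_ i) = skC (eps (l i)) by have [[]] := gwP i.
have g_coef i : forall m,
  skcoef (g_ i) m = 0 \/ skcoef (g_ i) m = iter m sigma (eps (l i)).
  by have [] := gwP i.
have g_deg i : forall m, (d i < m)%N -> skcoef (g_ i) m = 0.
  by have [] := gwP i.
have g_lead i : skcoef (g_ i) (d i) = iter (d i) sigma (eps (l i)).
  by have [] := gwP i.
have g_neq0 i : g_ i != 0.
  apply/eqP => gi0; have := g_lead i; rewrite gi0 skcoef0.
  have [k ->] := e_iter (d i) (l i) => e0.
  by have /eqP[] := eps_neq0 pi_irr epsP k.
pose g := \sum_i g_ i; pose v := 1 + \sum_i w_ i; pose E := \sum_i eps (l i).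
have skC_E : skC E = \sum_i skC (eps (l i)) :> skewpoly sigma.
  by rewrite /E (big_morph _ (@skCD _ sigma) (@skC0 _ sigma)).
have e_g : forall i, skC (eps (l i)) * g = g_ i.
  exact: (component_orbit_sum n_gt0 pi_monic pi_irr pi_inj pi_prod epsP
    sigma_inj sigma_surj l_inequiv g_comp).
have Eg : skC E * g = g.
  by rewrite skC_E mulr_suml; apply: eq_bigr => i _; apply: e_g.
have gv : g * v = skC E.
  rewrite skC_E mulr_suml; apply: eq_bigr => i _.
  rewrite -g_inv !mulrDr mulr_sumr; congr (_ + _).
  rewrite (bigD1 i) //= big1 ?addr0 // => j ne_ji; rewrite eq_sym in ne_ji.
  have g_other a : g_ i * skC (iter a sigma (eps (l j))) = 0.
    exact: (orbit_sum_mul_other n_gt0 pi_monic pi_irr pi_inj pi_prod epsP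
      sigma_inj sigma_surj l_inequiv g_coef).
  by have [_ _ _ _ -> //] := gwP j; [apply: (g_other 0%N) | apply: (g_other 1%N)].
(* the basis of A E: index s stands for a pair (i_ s, j_ s), j_ s < k_ (i_ s) *)
pose i_ := @tagnat.sig1 t k_; pose j_ s : nat := @tagnat.sig2 t k_ s.
pose b s := in_qpoly ('X^n - 1) 'X^(j_ s) * eps (l (i_ s)).
pose c : {linear cyclic_algebra F n -> 'rV[F]_(\sum_i k_ i)%N} :=
  @residue_coord F n r pi _ (l \o i_) j_.
have lt_j s : (j_ s < (size (pi (l (i_ s)))).-1)%N by apply: ltn_ord.
have dual_bc s : c (b s) = delta_mx 0 s.
  apply/rowP => s'; rewrite !mxE /b /=.
  rewrite (coef_residue_basis n_gt0 pi_monic pi_irr pi_prod epsP) //.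
  rewrite (inj_eq l_inj); congr (nat_of_bool _)%:R.
  apply/andP/eqP => [[/eqP eq_i /eqP eq_j]|->//].
  exact: tagnat_eq.
have expand a : a * E = \sum_s c a 0 s *: b s.
  have -> : \sum_s c a 0 s *: b s =
      \sum_s (residue pi (l (i_ s)) a)`_(j_ s) *: b s.
    by apply: eq_bigr => s _; rewrite mxE.
  rewrite (tagnat_sum k_ (fun i j => (residue pi (l i) a)`_j *:
    (in_qpoly ('X^n - 1) 'X^j * eps (l i)))).
  rewrite mulr_sumr; apply: eq_bigr => i _.
  exact: (eps_expand n_gt0 pi_monic pi_irr pi_inj pi_prod epsP).
have coef_bg s m : skcoef (skC (b s) * g) m =
    iter m sigma (in_qpoly ('X^n - 1) 'X^(j_ s)) * skcoef (g_ (i_ s)) m.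
  by rewrite /b skCM -mulrA e_g skcoefCM.
have lead_bg s :
    skcoef (skC (b s) * g) (d (i_ s)) = iter (d (i_ s)) sigma (b s).
  by rewrite coef_bg g_lead -iter_rmorphM.
exists (fun w => principal_left_ideal g (vec_to_skew sigma w)); split.
- have -> : (\sum_i k_ i * d i = \sum_s (d \o i_) s)%N.
    rewrite (tagnat_sum k_ (fun i _ => d i)).
    by apply: eq_bigr => i _; rewrite sum_nat_const card_ord.
  apply: (principal_code n_gt0 (c := c) dual_bc expand Eg gv) => [s m lt_dm|x].
    by rewrite coef_bg g_deg // mulr0.
  rewrite (eq_bigr (fun s => x s *: iter (d (i_ s)) sigma (b s))); last first.
    by move=> s _; rewrite lead_bg.
  move=> x0 s0; set i := i_ s0.
  (* multiplying by sigma^(d i) (eps (l i)) isolates the rows of block i, to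
     all of which the same injective map sigma^(d i) has been applied *)
  have : \sum_(s | i_ s == i) x s *: b s = 0.
    apply: (iter_sigma_inj sigma_inj (m := d i)).
    rewrite iter_rmorph0 iter_rmorph_sum.
    transitivity ((\sum_s x s *: iter (d (i_ s)) sigma (b s)) *
                  iter (d i) sigma (eps (l i))); last by rewrite x0 mul0r.
    rewrite mulr_suml big_mkcond; apply: eq_bigr => s _; rewrite -scalerAl.
    case: eqVneq => [<-|ne_s].
      by rewrite iter_linearZ -iter_rmorphM /b -mulrA e_idem.
    by rewrite /b iter_rmorphM -mulrA orth // mulr0 scaler0.
  by move/(dual_free dual_bc); apply.
- exact: sigma_cyclic_principal.
exists g; split.
- exact: (reduced_orbit_sum n_gt0 pi_monic pi_irr pi_inj pi_prod epsP
    sigma_inj sigma_surj l_inequiv g_comp g_coef).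
- exact: skew_image_principal.
- exact: (support_orbit_sum n_gt0 pi_monic pi_irr pi_inj pi_prod epsP
    sigma_inj sigma_surj l_inequiv g_comp g_neq0).
Qed.
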